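(* For every tree presentation $T$, the class $\mathcal{K}_T$ of all finite structures embeddable into $\mathcal{L}^*_T$ is a Fraïssé order class, and $\mathcal{L}^*_T$ is its Fraïssé limit.
   Context: Tree presentations are finite trees whose nodes are finite sequences of positive integers, each node labelled $\ell$ (leaf), $s$ (sum) or $\sigma$ (shuffle), defined inductively: $1$ is the tree consisting only of the root $\langle\rangle$, labelled $\ell$; if $T_1,\dots,T_k$ ($k\ge1$) are tree presentations then $s(T_1,\dots,T_k)$ (resp. $\sigma(T_1,\dots,T_k)$) is the tree whose nodes are the root $\langle\rangle$, labelled $s$ (resp. $\sigma$), together with the nodes $\langle i\rangle^\frown t$ for $1\le i\le k$ and $t\in T_i$, labelled as $t$ is in $T_i$. For a sequence $u$ and $i\le|u|$, $u\upharpoonright i$ is its initial segment of length $i$. Fix once and for all a partition $\langle\mathbb{Q}_n\rangle_{n\ge1}$ of $\mathbb{Q}$ into sets each dense in $\mathbb{Q}$, with $n\in\mathbb{Q}_n$. For $q\in\mathbb{Q}$ let $\#(q)$ be the $n$ with $q\in\mathbb{Q}_n$; for $\bar r=\langle r_0,\dots,r_{m-1}\rangle$ let $\#(\bar r)=\langle\#(r_0),\dots,\#(r_{m-1})\rangle$. $\mathcal{L}_T$ is the set of finite sequences $\bar r$ of rationals such that $\#(\bar r)$ is a leaf of $T$ and for each $i<|\bar r|$, if $\#(\bar r)\upharpoonright i$ is a sum node then $r_i=\#(r_i)$, ordered lexicographically. For a node $t$, $D_t$ is the set of $\bar r\in\mathcal{L}_T$ such that $\#(\bar r)$ extends $t$.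 $\mathcal{L}^*_T$ is the expansion of $(\mathcal{L}_T,<)$ by binary relations $E_t$ ($t\in T$), where $\bar r\,E_t\,\bar s$ iff $\bar r,\bar s\in D_t$ and $\bar r\upharpoonright|t|=\bar s\upharpoonright|t|$; its language is $\{<\}\cup\{E_t:t\in T\}$. For a finite relational language $L$, a class $\mathcal{K}$ of finite $L$-structures is a Fraïssé class if it is closed under embedded substructures (hereditary property), any two members embed into a common member (joint embedding property), and for embeddings $f:A\hookrightarrow B$, $g:A\hookrightarrow C$ with $A,B,C\in\mathcal{K}$ there are $D\in\mathcal{K}$ and embeddings $f':B\hookrightarrow D$, $g':C\hookrightarrow D$ with $f'\circ f=g'\circ g$ (amalgamation property). It is a Fraïssé order class if moreover a distinguished binary symbol $<$ is interpreted as a linear order in every member. The Fraïssé limit of a Fraïssé class $\mathcal{K}$ is the (unique up to isomorphism) countable ultrahomogeneous $L$-structure whose class of finite substructures up to isomorphism (its age) is $\mathcal{K}$; ultrahomogeneous means every isomorphism between finite substructures extends to an automorphism. *)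

(* Defs.v *)
From HB Require Import structures.
From mathcomp Require Import all_boot all_order all_algebra.
From mathcomp Require Import all_classical.

Set Implicit Arguments.
Unset Strict Implicit.
Unset Printing Implicit Defensive.

Import Order.TTheory GRing.Theory Num.Theory.

Local Open Scope classical_set_scope.
Local Open Scope ring_scope.

Record language := Language {
  symbol :> finType;
  arity : symbol -> nat }.

(* Carriers may be empty. *)
Record structure (L : language) := Structure {
  carrier :> Type;
  interp : forall R : L, ('I_(arity R) -> carrier) -> Prop }.

(* The binary relation (x, y) |-> R(x, y), meaningful when arity R = 2. *)
Definition binrel (L : language) (A : structure L) (R : L) (x y : A) : Prop :=
  interp (fun i : 'I_(arity R) => if val i == 0%N then x else y).

Definition embedding (L : language) (A B : structure L) (f : A -> B) : Prop :=
  injective f /\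
  forall (R : L) (v : 'I_(arity R) -> A), interp v <-> interp (f \o v).

Definition embeds (L : language) (A B : structure L) : Prop :=
  exists f : A -> B, embedding f.

Definition isomorphism (L : language) (A B : structure L) (f : A -> B) : Prop :=
  embedding f /\ bijective f.

Definition isomorphic (L : language) (A B : structure L) : Prop :=
  exists f : A -> B, isomorphism f.

Definition substructure (L : language) (M : structure L) (S : set M) :
    structure L :=
  @Structure L (set_type S)
    (fun (R : L) (v : 'I_(arity R) -> set_type S) =>
       interp (fun i => val (v i))).

Definition finite_structure (L : language) (A : structure L) : Prop :=
  finite_set [set: A].

Definition hereditary (L : language) (K : structure L -> Prop) : Prop :=
  forall A B : structure L, K B -> embeds A B -> K A.

Definition joint_embedding (L : language) (K : structure L -> Prop) : Prop :=
  forall A B : structure L, K A -> K B ->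
  exists C : structure L, [/\ K C, embeds A C & embeds B C].

Definition amalgamation (L : language) (K : structure L -> Prop) : Prop :=
  forall (A B C : structure L) (f : A -> B) (g : A -> C),
  K A -> K B -> K C -> embedding f -> embedding g ->
  exists (D : structure L) (f' : B -> D) (g' : C -> D),
    [/\ K D, embedding f', embedding g' & f' \o f = g' \o g].

Definition fraisse_class (L : language) (K : structure L -> Prop) : Prop :=
  [/\ forall A : structure L, K A -> finite_structure A,
      hereditary K, joint_embedding K & amalgamation K].

Definition strict_linear_order (X : Type) (r : X -> X -> Prop) : Prop :=
  [/\ forall x, ~ r x x,
      forall x y z, r x y -> r y z -> r x z
    & forall x y, [\/ r x y, x = y | r y x]].

Definition fraisse_order_class (L : language) (lt : L)
    (K : structure L -> Prop) : Prop :=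
  [/\ arity lt = 2%N, fraisse_class K
    & forall A : structure L, K A -> strict_linear_order (@binrel L A lt)].

Definition age (L : language) (M A : structure L) : Prop :=
  exists S : set M, finite_set S /\ isomorphic A (substructure S).

Definition ultrahomogeneous (L : language) (M : structure L) : Prop :=
  forall (S S' : set M) (f : substructure S -> substructure S'),
  finite_set S -> finite_set S' -> isomorphism f ->
  exists g : M -> M, isomorphism g /\
    forall x : substructure S, g (val x) = val (f x).

Definition fraisse_limit (L : language) (K : structure L -> Prop)
    (M : structure L) : Prop :=
  [/\ countable [set: M], ultrahomogeneous M
    & forall A : structure L, K A <-> age M A].

(* [tp_sum T1 [:: T2; ..; Tk]] is s(T1, .., Tk), which forces k >= 1; likewise
   for [tp_shuffle]. *)
Inductive tree_presentation :=
  | tp_one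
  | tp_sum of tree_presentation & seq tree_presentation
  | tp_shuffle of tree_presentation & seq tree_presentation.

Inductive node_label := leaf_label | sum_label | shuffle_label.

Definition node_label_code (l : node_label) : option bool :=
  match l with
  | leaf_label => None | sum_label => Some true | shuffle_label => Some false
  end.

Definition node_label_decode (c : option bool) : node_label :=
  match c with
  | None => leaf_label | Some true => sum_label | Some false => shuffle_label
  end.

Lemma node_label_codeK : cancel node_label_code node_label_decode.
Proof. by case. Qed.

HB.instance Definition _ := Equality.copy node_label (can_type node_label_codeK).

(* A labelled tree, given as the list of its (node, label) pairs: a root
   labelled l, and below it the nodes <i>^t for t in the i-th subtree. *)
Definition graft (l : node_label) (ts : seq (seq (seq nat * node_label))) :
    seq (seq nat * node_label) :=
  ([::], l) ::
  flatten [seq [seq (i.+1 :: p.1, p.2) | p <- nth [::] ts i]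
          | i <- iota 0 (size ts)].

Fixpoint labelled_nodes (T : tree_presentation) : seq (seq nat * node_label) :=
  match T with
  | tp_one => [:: ([::], leaf_label)]
  | tp_sum T1 Ts => graft sum_label (labelled_nodes T1 :: map labelled_nodes Ts)
  | tp_shuffle T1 Ts =>
      graft shuffle_label (labelled_nodes T1 :: map labelled_nodes Ts)
  end.

Definition has_label (T : tree_presentation) (t : seq nat) (l : node_label) :
    bool :=
  (t, l) \in labelled_nodes T.

Definition nodes (T : tree_presentation) : seq (seq nat) :=
  unzip1 (labelled_nodes T).

(* A partition (Q_n)_(n >= 1) of the rationals is given by the map sharp
   sending q to the unique n with q in Q_n. *)
Definition dense_partition (sharp : rat -> nat) : Prop :=
  [/\ forall q : rat, (0 < sharp q)%N,
      forall n : nat, (0 < n)%N ->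
        forall a b : rat, a < b -> exists2 q, a < q < b & sharp q = n
    & forall n : nat, (0 < n)%N -> sharp n%:R = n].

Definition in_LT (sharp : rat -> nat) (T : tree_presentation) (r : seq rat) :
    bool :=
  has_label T (map sharp r) leaf_label &&
  [forall i : 'I_(size r),
     has_label T (take i (map sharp r)) sum_label ==>
     (nth 0 r i == (sharp (nth 0 r i))%:R)].

Definition LT (sharp : rat -> nat) (T : tree_presentation) : Type :=
  {r : seq rat | in_LT sharp T r}.

Definition LT_lt (sharp : rat -> nat) (T : tree_presentation)
    (r s : LT sharp T) : bool :=
  ((val r : seqlexi rat) < (val s : seqlexi rat))%O.

Definition LT_D (sharp : rat -> nat) (T : tree_presentation) (t : seq nat)
    (r : LT sharp T) : bool :=
  prefix t (map sharp (val r)).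

Definition LT_E (sharp : rat -> nat) (T : tree_presentation) (t : seq nat)
    (r s : LT sharp T) : bool :=
  [&& LT_D t r, LT_D t s & take (size t) (val r) == take (size t) (val s)].

(* The symbol None is <, and Some t is E_t. *)
Definition LT_language (T : tree_presentation) : language :=
  @Language (option (seq_sub (nodes T))) (fun=> 2%N).

Definition lt_symbol (T : tree_presentation) : LT_language T := None.

Definition LT_star (sharp : rat -> nat) (T : tree_presentation) :
    structure (LT_language T) :=
  @Structure (LT_language T) (LT sharp T)
    (fun (R : LT_language T) (v : 'I_2 -> LT sharp T) =>
       match R with
       | None => LT_lt (v ord0) (v ord_max)
       | Some t => LT_E (val t) (v ord0) (v ord_max)
       end).

Definition K_T (sharp : rat -> nat) (T : tree_presentation)
    (A : structure (LT_language T)) : Prop :=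
  finite_structure A /\ embeds A (LT_star sharp T).

(* Main.v *)
Require Import Defs.
From mathcomp Require Import all_boot all_order all_algebra.
From mathcomp Require Import all_classical.

Set Implicit Arguments.
Unset Strict Implicit.
Unset Printing Implicit Defensive.

Import Order.TTheory GRing.Theory Num.Theory.

Local Open Scope classical_set_scope.

(** Everything follows from ultrahomogeneity of [LT_star]: the hereditary and
    joint embedding properties hold for the finite substructures of any
    structure, and amalgamation comes from extending an isomorphism between two
    copies of the base to an automorphism. Ultrahomogeneity is a back-and-forth
    argument. Given a finite partial isomorphism and a new point [x], let [j] be
    the largest length of an initial segment that [x] shares with a point [s] of
    the domain. The image of [x] copies the first [j] entries of the image of
    [s]; its entry of index [j] is forced at a sum node, and at a shuffle node
    it is found in the right cut by density of the colour classes; the later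
    entries are arbitrary of the right colours. The leaves of [T] form an
    antichain for the prefix order, so two distinct points always differ at an
    index that is valid for both. *)

(** * Finite substructures, joint embedding and amalgamation *)

Section Structures.
Variable L : language.
Implicit Types A B C M : structure L.

Lemma embedding_comp A B C (f : A -> B) (g : B -> C) :
  embedding f -> embedding g -> embedding (g \o f).
Proof.
move=> [finj fE] [ginj gE]; split; first exact: inj_comp.
by move=> R v; rewrite fE gE.
Qed.

Lemma embedding_val M (S : set M) :
  embedding (fun x : substructure S => val x).
Proof. by split=> //; exact: val_inj. Qed.

Lemma inj_surj_bijective (X Y : Type) (f : X -> Y) :
  injective f -> (forall y, exists x, f x = y) -> bijective f.
Proof.
move=> finj /choice[g gK]; exists g => // x.
by apply: finj; rewrite gK.
Qed.

Lemma isomorphism_inv A B (f : A -> B) (g : B -> A) :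
  embedding f -> cancel f g -> cancel g f -> isomorphism g.
Proof.
move=> [finj fE] fK gK; split; last by exists f.
split=> [|R v]; first exact: can_inj gK.
rewrite fE; have -> // : f \o (g \o v) = v.
by apply/funext => i /=; rewrite gK.
Qed.

Lemma embedding_corestrict A M (h : A -> M) (S : set M) :
  embedding h -> (forall a, S (h a)) ->
  exists2 h' : A -> substructure S, embedding h' & forall a, val (h' a) = h a.
Proof.
move=> [hinj hE] hS; exists (fun a => exist _ (h a) (mem_set (hS a))) => //.
by split=> [a b /(congr1 val) /hinj|R v] //; rewrite hE.
Qed.

Lemma isomorphism_range A M (h : A -> M) : embedding h ->
  exists2 h' : A -> substructure (range h),
    isomorphism h' & forall a, val (h' a) = h a.
Proof.
move=> hE; have [|h' h'E h'K] := embedding_corestrict (S := range h) hE.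
  by move=> a; exists a.
exists h' => //; split=> //; apply: inj_surj_bijective; first exact: h'E.1.
move=> y; have [a _ ay] := set_valP y; exists a.
by apply: val_inj; rewrite h'K.
Qed.

Lemma finite_substructure M (S : set M) :
  finite_set S -> finite_structure (substructure S).
Proof.
move=> Sfin; rewrite /finite_structure; have -> : [set: substructure S] = val @^-1` S.
  by apply/seteqP; split=> // x _; exact: set_valP.
by apply: finite_preimage => // x y _ _; exact: val_inj.
Qed.

Lemma finite_structure_embeds A B :
  finite_structure B -> embeds A B -> finite_structure A.
Proof.
move=> Bfin [f [finj _]]; rewrite /finite_structure.
rewrite -(preimage_setT f); apply: finite_preimage => // x y _ _.
exact: finj.
Qed.

(** [K_T sharp T] is the instance at [LT_star sharp T], by conversion. *)
Definition finitely_embeds M A : Prop := finite_structure A /\ embeds A M.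

Lemma finitely_embeds_age M A : finitely_embeds M A <-> age M A.
Proof.
split=> [[Afin [h hE]]|[S [Sfin [h [hE _]]]]].
  have [h' h'iso _] := isomorphism_range hE.
  by exists (range h); split; [exact: finite_image|exists h'].
split; first by apply: finite_structure_embeds (ex_intro _ h hE);
  exact: finite_substructure.
by exists (val \o h); apply: embedding_comp hE _; exact: embedding_val.
Qed.

Lemma finitely_embeds_hereditary M : hereditary (finitely_embeds M).
Proof.
move=> A B [Bfin [g gE]] [f fE]; split.
  by apply: finite_structure_embeds Bfin _; exists f.
by exists (g \o f); exact: embedding_comp.
Qed.

(** [D] is induced on the union of the two ranges; the inclusion [i] is kept so that equations
    between maps into [D] can be checked in [M]. *)
Lemma finitely_embeds_union M A B (f : A -> M) (g : B -> M) :
  finite_structure A -> finite_structure B -> embedding f -> embedding g ->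
  exists (D : structure L) (f' : A -> D) (g' : B -> D) (i : D -> M),
    [/\ finitely_embeds M D, embedding f' & embedding g'] /\
    [/\ injective i, i \o f' = f & i \o g' = g].
Proof.
move=> Afin Bfin fE gE; pose S := range f `|` range g.
have [|f' f'E f'K] := embedding_corestrict (S := S) fE.
  by move=> a; left; exists a.
have [|g' g'E g'K] := embedding_corestrict (S := S) gE.
  by move=> b; right; exists b.
exists (substructure S), f', g', val; split; last first.
  by split; [exact: val_inj|exact/funext|exact/funext].
split=> //; split; last by exists val; exact: embedding_val.
by apply: finite_substructure; rewrite finite_setU; split; exact: finite_image.
Qed.

Lemma finitely_embeds_joint_embedding M : joint_embedding (finitely_embeds M).
Proof.
move=> A B [Afin [f fE]] [Bfin [g gE]].
have [D [f' [g' [_ [[? ? ?] _]]]]] := finitely_embeds_union Afin Bfin fE gE.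
by exists D; split=> //; [exists f'|exists g'].
Qed.

(** An automorphism [h] carries the copy of [A] obtained through [B] onto the one obtained through
    [C]. Once [B] is moved by [h], the copies of [B] and [C] agree on [A], and their union
    amalgamates. *)
Lemma ultrahomogeneous_amalgamation M :
  ultrahomogeneous M -> amalgamation (finitely_embeds M).
Proof.
move=> Mhom A B C f g [Afin _] [Bfin [b bE]] [Cfin [c cE]] fE gE.
have bfE := embedding_comp fE bE; have cgE := embedding_comp gE cE.
have [p [pE [p' pK p'K]] pval] := isomorphism_range bfE.
have [q [qE qbij] qval] := isomorphism_range cgE.
have [p'E p'bij] := isomorphism_inv pE pK p'K.
have qp'iso : isomorphism (q \o p').
  by split; [exact: embedding_comp|exact: bij_comp].
have [h [[hE _] hext]] :=
  Mhom _ _ _ (finite_image _ Afin) (finite_image _ Afin) qp'iso.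
have hbE := embedding_comp bE hE.
have [D [f' [g' [i [[DK f'E g'E] [iinj if' ig']]]]]] :=
  finitely_embeds_union Bfin Cfin hbE cE.
exists D, f', g'; split=> //; apply/funext => a /=; apply: iinj.
have -> : i (f' (f a)) = h (b (f a)) by exact: (congr1 (fun k => k (f a)) if').
have -> : i (g' (g a)) = c (g a) by exact: (congr1 (fun k => k (g a)) ig').
by have := hext (p a); rewrite /= pK pval qval.
Qed.

End Structures.

(** * Back-and-forth on a countable type *)

(** The graph of [g] is the union of an increasing chain of lists satisfying [C]. The final clause
    transfers to [g] whatever [C] guarantees for two pairs. *)
Lemma back_and_forth (M : countType) (C : seq (M * M) -> Prop)
    (P0 : seq (M * M)) :
  (forall P p q, C P -> p \in P -> q \in P -> (p.1 == q.1) = (p.2 == q.2)) ->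
  (forall P x, C P -> exists y, C ((x, y) :: P)) ->
  (forall P y, C P -> exists x, C ((x, y) :: P)) ->
  C P0 ->
  exists2 g : M -> M, bijective g &
    (forall x y, (x, y) \in P0 -> g x = y) /\
    (forall x x', exists P, [/\ C P, (x, g x) \in P & (x', g x') \in P]).
Proof.
move=> Cinj Cforth Cback C0.
(* Stage [n] adds the element coded by [n], if there is one, first to the domain and then to the
   range. *)
have step (Pn : {P | C P} * nat) : exists Q : {P | C P},
    {subset sval Pn.1 <= sval Q} /\ forall x : M, unpickle Pn.2 = Some x ->
    (exists y, (x, y) \in sval Q) /\ (exists z, (z, x) \in sval Q).
  case: Pn => [[P CP] n] /=; case: (unpickle n) => [x|]; last first.
    by exists (exist _ P CP); split.
  have [y CPy] := Cforth _ x CP; have [z CQ] := Cback _ x CPy.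
  exists (exist _ _ CQ); split=> /= [p pP|_ [<-]]; first by rewrite !inE pP !orbT.
  by split; [exists y|exists z]; rewrite !inE eqxx ?orbT.
have [F FP] := choice step.
pose St := fix St n := if n is m.+1 then F (St m, m) else exist _ P0 C0.
have St_mono m n : (m <= n)%N -> {subset sval (St m) <= sval (St n)}.
  elim: n => [|n IH]; first by rewrite leqn0 => /eqP->.
  rewrite leq_eqVlt => /orP[/eqP->//|/IH sub] p /sub.
  exact: (FP (St n, n)).1.
have tot x : exists y, exists n, (x, y) \in sval (St n).
  have [[y xy] _] := (FP (St (pickle x), pickle x)).2 _ (pickleK x).
  by exists y, (pickle x).+1.
have sur y : exists x, exists n, (x, y) \in sval (St n).
  have [_ [x xy]] := (FP (St (pickle y), pickle y)).2 _ (pickleK y).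
  by exists x, (pickle y).+1.
have common x y m x' y' n : (x, y) \in sval (St m) -> (x', y') \in sval (St n) ->
    (x, y) \in sval (St (maxn m n)) /\ (x', y') \in sval (St (maxn m n)).
  by move=> xy xy'; split; [apply: St_mono xy|apply: St_mono xy'];
    rewrite ?leq_maxl ?leq_maxr.
have St_inj x y m x' y' n : (x, y) \in sval (St m) -> (x', y') \in sval (St n) ->
    (x == x') = (y == y').
  move=> xy xy'; have [h h'] := common _ _ _ _ _ _ xy xy'.
  exact: (Cinj _ (x, y) (x', y') (svalP (St (maxn m n)))).
have [g gP] := choice tot; have [g' g'P] := choice sur.
have [k kP] := choice gP.
exists g; last split.
- exists g' => x.
    by have [n xy] := g'P (g x); apply/eqP; rewrite (St_inj _ _ _ _ _ _ xy (kP x)).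
  by have [n xy] := g'P x; apply/eqP; rewrite -(St_inj _ _ _ _ _ _ (kP _) xy).
- move=> x y xy; apply/eqP.
  by rewrite -(St_inj _ _ _ _ _ 0%N (kP x) xy).
move=> x x'; exists (sval (St (maxn (k x) (k x')))).
have [h h'] := common _ _ _ _ _ _ (kP x) (kP x').
by split=> //; exact: svalP.
Qed.

(** * Lexicographic comparison and finite cuts in the rationals *)

Section Lexicographic.
Local Open Scope order_scope.
Variables (d : Order.disp_t) (X : orderType d).
Implicit Types (a b c : seqlexi X) (x y : X).

Lemma ltxi_take (n : nat) a b : take n a != take n b ->
  (a < b) = ((take n a : seqlexi X) < (take n b : seqlexi X)).
Proof.
elim: n a b => [|n IH] [|x a] [|y b] //=.
have [<-|xy] := eqVneq x y; last by rewrite !neqhead_ltxiE.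
by rewrite eqseq_cons eqxx /= !eqhead_ltxiE; exact: IH.
Qed.

(** Once [a] and [b] differ within their first [n] entries, the entries of [a] from index [n] on do
    not affect the comparison. *)
Lemma ltxi_takel n a a' b : take n a = take n a' -> take n a != take n b ->
  (a < b) = (a' < b).
Proof. by move=> e ab; rewrite (ltxi_take ab) e -ltxi_take -?e. Qed.

Lemma ltxi_taker n a b b' : take n b = take n b' -> take n a != take n b ->
  (a < b) = (a < b').
Proof. by move=> e ab; rewrite (ltxi_take ab) e -ltxi_take -?e. Qed.

Lemma ltxi_cat_cons c x y a b : x != y ->
  ((c ++ x :: a : seqlexi X) < (c ++ y :: b : seqlexi X)) = (x < y).
Proof.
move=> xy; elim: c => [|z c IH] /=; first by rewrite neqhead_ltxiE.
by rewrite eqhead_ltxiE.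
Qed.

Lemma ex_max_seq (s : seq X) : s != [::] ->
  exists2 m, m \in s & forall x, x \in s -> x <= m.
Proof.
elim: s => // z [|z' s] IH _.
  by exists z => [|x]; rewrite !inE // => /eqP->.
have [//|m ms mP] := IH; have [zm|mz] := leP z m.
  by exists m => [|x]; rewrite inE ?ms ?orbT // => /orP[/eqP->//|/mP].
exists z => [|x]; rewrite inE ?eqxx // => /orP[/eqP->//|/mP xm].
exact: le_trans xm (ltW mz).
Qed.

End Lexicographic.

Lemma ex_min_seq (d : Order.disp_t) (X : orderType d) (s : seq X) :
  s != [::] -> exists2 m, m \in s & forall x, x \in s -> (m <= x)%O.
Proof. exact: (@ex_max_seq _ X^d). Qed.

(** Density concerns bounded intervals, so the cut is first replaced by the interval from the
    maximum of [A] to the minimum of [B]; an empty side is given an arbitrary endpoint. *)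
Lemma dense_partition_cut (sharp : rat -> nat) (A B : seq rat) (n : nat) :
  dense_partition sharp -> (0 < n)%N ->
  (forall a b, a \in A -> b \in B -> (a < b)%R) ->
  exists q, [/\ sharp q = n, forall a, a \in A -> (a < q)%R
              & forall b, b \in B -> (q < b)%R].
Proof.
move=> [_ dense _] n0 AB.
suff [lo [hi [lohi Alo hiB]]] : exists lo hi : rat, [/\ (lo < hi)%R,
    forall a, a \in A -> (a <= lo)%R & forall b, b \in B -> (hi <= b)%R].
  have [q /andP[loq qhi] qn] := dense n n0 _ _ lohi.
  exists q; split=> // [a /Alo ale|b /hiB leb].
    exact: le_lt_trans ale loq.
  exact: lt_le_trans qhi leb.
have [->|A0] := eqVneq A [::].
  have [->|B0] := eqVneq B [::]; first by exists 0%R, 1%R.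
  have [hi _ hiB] := ex_min_seq B0.
  by exists (hi - 1)%R, hi; split=> //; rewrite ltrBlDr ltrDl.
have [lo loA Alo] := ex_max_seq A0.
have [->|B0] := eqVneq B [::].
  by exists lo, (lo + 1)%R; split=> //; rewrite ltrDl.
have [hi hiB Bhi] := ex_min_seq B0.
by exists lo, hi; split=> //; exact: AB.
Qed.

(** * Nodes and leaves of a tree presentation *)

Definition root_label (T : tree_presentation) : node_label :=
  match T with
  | tp_one => leaf_label
  | tp_sum _ _ => sum_label
  | tp_shuffle _ _ => shuffle_label
  end.

Definition children (T : tree_presentation) : seq tree_presentation :=
  match T with
  | tp_one => [::]
  | tp_sum T1 Ts => T1 :: Ts
  | tp_shuffle T1 Ts => T1 :: Ts
  end.

(** A leaf is read as a node without children, which treats the three constructors uniformly. *)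
Lemma labelled_nodesE T :
  labelled_nodes T = graft (root_label T) (map labelled_nodes (children T)).
Proof. by case: T. Qed.

Lemma has_label_nil T l : has_label T [::] l = (l == root_label T).
Proof.
rewrite /has_label labelled_nodesE inE /= xpair_eqE eqxx /=.
case: eqP => //= _; apply/negP => /flattenP[s /mapP[i _ ->] /mapP[p _ []]].
by [].
Qed.

(** With [has_label_nil], this allows induction on the node with the tree generalised, instead of
    induction on the nested type of trees. *)
Lemma has_label_cons T n t l : reflect
  (exists2 i, n = i.+1 & (i < size (children T))%N /\
     has_label (nth tp_one (children T) i) t l)
  (has_label T (n :: t) l).
Proof.
rewrite /has_label labelled_nodesE inE xpair_eqE /=.
apply: (iffP flattenP) => [[s /mapP[i]]|[i -> [ilt tl]]].
  rewrite size_map mem_iota /= add0n => ilt -> /mapP[[t' l'] tl [-> -> ->]].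
  by exists i => //; split=> //; rewrite (nth_map tp_one) in tl.
exists [seq (i.+1 :: p.1, p.2)
       | p <- nth [::] [seq labelled_nodes j | j <- children T] i].
  by apply/mapP; exists i => //; rewrite size_map mem_iota.
by apply/mapP; exists (t, l) => //; rewrite (nth_map tp_one).
Qed.

Lemma nodesP T t : reflect (exists l, has_label T t l) (t \in nodes T).
Proof.
apply: (iffP mapP) => [[[t' l] tl ->]|[l tl]]; first by exists l.
by exists (t, l).
Qed.

Lemma take_nodes T t n : t \in nodes T -> take n t \in nodes T.
Proof.
move=> /nodesP[l tl]; apply/nodesP; elim: t T n tl => [|m t IH] T [|n] //= tl.
- by exists l.
- by exists (root_label T); rewrite has_label_nil.
- by exists (root_label T); rewrite has_label_nil.
have /has_label_cons[i -> [ilt til]] := tl.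
by have [l' l'P] := IH _ n til; exists l'; apply/has_label_cons; exists i.
Qed.

(** A tree whose root is a leaf has no children, so no node properly extends a leaf. *)
Lemma leaf_prefix T t u l :
  has_label T t leaf_label -> has_label T u l -> prefix t u -> t = u.
Proof.
elim: t T u => [|m t IH] T [|n u] //.
  rewrite has_label_nil => /eqP Tl /has_label_cons[i _ [+ _]].
  by case: T Tl.
move=> /has_label_cons[i -> [_ ti]] /has_label_cons[j -> [_ uj]].
rewrite prefix_cons => /andP[/eqP[ij] tu]; rewrite -ij in uj *.
by rewrite (IH _ _ ti uj tu).
Qed.

(** The two sequences differ at index [size c], so longer initial segments cannot agree. *)
Lemma take_cat_cons_eq (X : eqType) (c d : seq X) x y u v n :
  size c = size d -> x != y ->
  (take n (c ++ x :: u) == take n (d ++ y :: v)) =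
  (take n c == take n d) && (n <= size c)%N.
Proof.
move=> + xy; elim: c d n => [|z c IH] [|z' d] [|n] //=.
  by rewrite eqseq_cons (negPf xy).
by move=> [cd]; rewrite !eqseq_cons IH // andbA.
Qed.

Lemma seq_split_nth (X : Type) (x0 : X) (s : seq X) n : (n < size s)%N ->
  s = take n s ++ nth x0 s n :: drop n.+1 s.
Proof. by move=> ns; rewrite -drop_nth // cat_take_drop. Qed.

(** * Partial isomorphisms and their one-point extensions *)

Section PartialIsomorphisms.
Variables (sharp : rat -> nat) (T : tree_presentation).
Hypothesis hsharp : dense_partition sharp.
Notation M := (LT sharp T).
Implicit Types (r s x y : M) (P : seq (M * M)).

Lemma in_LTP (r : seq rat) : reflect
  (has_label T (map sharp r) leaf_label /\
   forall i, (i < size r)%N -> has_label T (take i (map sharp r)) sum_label ->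
     nth 0%R r i = ((sharp (nth 0%R r i))%:R)%R)
  (in_LT sharp T r).
Proof.
apply: (iffP andP) => [[rl /forallP rs]|[rl rs]]; split=> //.
  by move=> i ir isum; have := rs (Ordinal ir); rewrite /= isum => /eqP.
by apply/forallP => i; apply/implyP => isum; apply/eqP/rs.
Qed.

(** The colour sequences are leaves, one a prefix of the other, hence equal; so [r] and [s] have the
    same length. *)
Lemma LT_prefix r s : prefix (val r) (val s) -> val r = val s.
Proof.
have [rl _] := in_LTP _ (valP r); have [sl _] := in_LTP _ (valP s).
move=> rs; have /(leaf_prefix rl sl)/(congr1 size) :
  prefix (map sharp (val r)) (map sharp (val s)).
  by case/prefixP: rs => t ->; rewrite map_cat prefix_prefix.
by move: rs; rewrite !size_map prefixE => /eqP + e; rewrite e take_size.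
Qed.

(** Otherwise [s] would be a proper initial segment of [r]. *)
Lemma LT_size_take r s n :
  take n (val s) = take n (val r) -> (n < size (val r))%N ->
  (n < size (val s))%N.
Proof.
move=> sr nr; rewrite ltnNge; apply/negP => sn.
have /LT_prefix e : prefix (val s) (val r).
  by rewrite -(take_oversize sn) sr prefix_take.
by move: nr; rewrite -e ltnNge sn.
Qed.

(** If [n] is at least the length of [r], the node is the leaf of [r], and [LT_prefix] forces [s] to
    equal [r] on either side. *)
Lemma LT_E_take r s n :
  LT_E (take n (map sharp (val r))) r s = (take n (val r) == take n (val s)).
Proof.
rewrite /LT_E /LT_D prefix_take /= size_take size_map.
case: ltnP => [nr|rn].
  apply/andP/idP => [[]//|/eqP rs]; split; last exact/eqP.
  by rewrite -map_take rs map_take prefix_take.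
rewrite take_size [take n (map _ _)]take_oversize ?size_map //.
rewrite [take n (val r)]take_oversize //.
apply/andP/eqP => [[_ /eqP rs]|rs].
  have /LT_prefix <- : prefix (val r) (val s) by rewrite prefixE -rs.
  by rewrite take_oversize.
have /LT_prefix <- : prefix (val r) (val s) by rewrite rs prefix_take.
by rewrite prefix_refl take_size.
Qed.

(* By [partial_isoP], these are the graphs of isomorphisms between finite
   substructures. *)
Definition partial_iso P : Prop := forall p q, p \in P -> q \in P ->
  [/\ map sharp (val p.1) = map sharp (val p.2),
      forall n, (take n (val p.1) == take n (val q.1)) =
                (take n (val p.2) == take n (val q.2))
    & LT_lt p.1 q.1 = LT_lt p.2 q.2].

Lemma partial_iso_size P p : partial_iso P -> p \in P ->
  size (val p.1) = size (val p.2).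
Proof.
move=> PI pP; have [/(congr1 size)] := PI _ _ pP pP.
by rewrite !size_map.
Qed.

Lemma partial_iso_inj P p q :
  partial_iso P -> p \in P -> q \in P -> (p.1 == q.1) = (p.2 == q.2).
Proof.
move=> PI pP qP; have [_ tE _] := PI _ _ pP qP.
pose n := maxn (size (val p.1)) (size (val q.1)).
have := tE n; rewrite !take_oversize // -?(partial_iso_size PI) //.
- by rewrite leq_maxr.
- by rewrite leq_maxl.
- by rewrite leq_maxr.
- by rewrite leq_maxl.
Qed.

Lemma partial_iso_cons P x y : partial_iso P ->
  map sharp (val x) = map sharp (val y) ->
  (forall p, p \in P ->
   [/\ forall n, (take n (val x) == take n (val p.1)) =
                 (take n (val y) == take n (val p.2)),
       LT_lt x p.1 = LT_lt y p.2 & LT_lt p.1 x = LT_lt p.2 y]) ->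
  partial_iso ((x, y) :: P).
Proof.
move=> PI xy xyP p q; rewrite !inE => /orP[/eqP->|pP] /orP[/eqP->|qP] /=.
- by split=> // [n|]; rewrite ?eqxx // /LT_lt !ltxx.
- by have [] := xyP _ qP.
- have [tE _ ?] := xyP _ pP; have [? _ _] := PI _ _ pP pP.
  by split=> // n; rewrite eq_sym tE eq_sym.
- exact: PI.
Qed.

Lemma partial_iso_swap P :
  partial_iso P -> partial_iso [seq (p.2, p.1) | p <- P].
Proof.
move=> PI _ _ /mapP[p pP ->] /mapP[q qP ->] /=.
by have [-> tE ->] := PI _ _ pP qP; split.
Qed.

(* On a common prefix of length [n], a partial isomorphism induces a strictly
   increasing map on the entries of index [n]. *)
Lemma partial_iso_nth_lt P n p q : partial_iso P -> p \in P -> q \in P ->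
  take n (val p.1) = take n (val q.1) ->
  (n < size (val p.1))%N -> (n < size (val q.1))%N ->
  (nth 0 (val p.1) n < nth 0 (val q.1) n)%R ->
  (nth 0 (val p.2) n < nth 0 (val q.2) n)%R.
Proof.
move=> PI pP qP pq np nq ltpq; have [_ tE ltE] := PI _ _ pP qP.
have np2 : (n < size (val p.2))%N by rewrite -(partial_iso_size PI).
have nq2 : (n < size (val q.2))%N by rewrite -(partial_iso_size PI).
have pq2 : take n (val p.2) = take n (val q.2).
  by apply/eqP; rewrite -tE pq.
(* Agreement up to [n.+1] fails for [p.1] and [q.1], hence for their images: these differ at index
   [n], where the order is therefore decided. *)
have := tE n.+1; rewrite !(take_nth 0%R) // !eqseq_rcons pq pq2 !eqxx /=.
rewrite (lt_eqF ltpq) => /esym/negbT neq2.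
rewrite -(ltxi_cat_cons (take n (val p.2)) (drop n.+1 (val p.2))
  (drop n.+1 (val q.2)) neq2) {2}pq2 -!seq_split_nth //.
move: ltE; rewrite /LT_lt => <-.
rewrite (seq_split_nth 0%R np) (seq_split_nth 0%R nq) pq.
by rewrite ltxi_cat_cons // lt_eqF.
Qed.

Lemma partial_iso_entry P n x : partial_iso P -> (n < size (val x))%N ->
  exists q : rat, [/\ sharp q = sharp (nth 0%R (val x) n),
    has_label T (take n (map sharp (val x))) sum_label -> q = (sharp q)%:R%R
    & forall p, p \in P -> take n (val p.1) = take n (val x) ->
      ((nth 0 (val x) n < nth 0 (val p.1) n)%R -> (q < nth 0 (val p.2) n)%R) /\
      ((nth 0 (val p.1) n < nth 0 (val x) n)%R -> (nth 0 (val p.2) n < q)%R)].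
Proof.
move=> PI nx; have [_ xsum] := in_LTP _ (valP x).
have [nsum|nosum] := boolP (has_label T (take n (map sharp (val x))) sum_label).
  exists (nth 0%R (val x) n); split=> // [_|p pP px]; first exact: xsum.
  (* At a sum node an entry is the integer naming its colour, and colours are preserved. *)
  suff -> : nth 0%R (val p.2) n = nth 0%R (val p.1) n by [].
  have [pE _ _] := PI _ _ pP pP.
  have np := LT_size_take px nx.
  have np2 : (n < size (val p.2))%N by rewrite -(partial_iso_size PI).
  have nsum1 : has_label T (take n (map sharp (val p.1))) sum_label.
    by rewrite -map_take px map_take.
  have [_ p1sum] := in_LTP _ (valP p.1); have [_ p2sum] := in_LTP _ (valP p.2).
  rewrite (p1sum n) // (p2sum n) //; last by rewrite -pE.
  by rewrite -!(nth_map _ 0%N) // pE.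
(* Only points sharing the first [n] entries of [x] constrain [q]; [A] and [B] collect the image
   entries that must lie below and above it. *)
pose Pn := [seq p <- P | take n (val p.1) == take n (val x)].
pose A := [seq nth 0%R (val p.2) n | p <- Pn &
  (nth 0 (val p.1) n < nth 0 (val x) n)%R].
pose B := [seq nth 0%R (val p.2) n | p <- Pn &
  (nth 0 (val x) n < nth 0 (val p.1) n)%R].
have [|a b|q [qE qA qB]] :=
  @dense_partition_cut sharp A B (sharp (nth 0%R (val x) n)) hsharp.
- by case: hsharp.
- move=> /mapP[p]; rewrite !mem_filter => /and3P[ltp /eqP px pP] ->.
  move=> /mapP[p']; rewrite !mem_filter => /and3P[ltp' /eqP p'x p'P] ->.
  apply: (partial_iso_nth_lt PI) => //; first by rewrite px.
  - exact: LT_size_take px nx.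
  - exact: LT_size_take p'x nx.
  - exact: lt_trans ltp ltp'.
exists q; split=> // p pP px; split=> lt.
  by apply/qB/mapP; exists p => //; rewrite !mem_filter lt px eqxx.
by apply/qA/mapP; exists p => //; rewrite !mem_filter lt px eqxx.
Qed.

(* The new image branches off from the images at the same depth [j] as [x]
   branches off from the domain; only the entry of index [j] has to be placed
   carefully. *)
Lemma partial_iso_forth P x : partial_iso P ->
  exists y, partial_iso ((x, y) :: P).
Proof.
move=> PI; pose Q j := (j <= size (val x))%N &&
  has (fun p : M * M => take j (val p.1) == take j (val x)) P.
(* With an empty domain no [j] satisfies [Q], and [x] can be sent to itself. *)
have [->|P0] := eqVneq P [::].
  by exists x; apply: partial_iso_cons.
have exQ : exists j, Q j.
  by exists 0%N; rewrite /Q; case: (P) P0 => // p P' _; rewrite /= !take0 eqxx.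
have Qub j : Q j -> (j <= size (val x))%N by case/andP.
case: (ex_maxnP exQ Qub) => j /andP[jx /hasP[[s s'] ssP /= /eqP sx]] jmax.
have [sE _ _] := PI _ _ ssP ssP; rewrite /= in sE.
(* If [j] is the whole length of [x], then [x] is an initial segment of [s], so [x] is [s] and its
   image is already known. *)
move: jx; rewrite leq_eqVlt => /orP[/eqP jx|jx].
  have xs : x = s.
    apply: val_inj; apply: LT_prefix.
    by rewrite -[X in prefix X]take_size -jx -sx prefix_take.
  exists s'; rewrite xs => p q; rewrite !inE => /predU1P pP /predU1P qP.
  by apply: PI; [case: pP => [->|]|case: qP => [->|]].
have [q [qE qsum qP]] := partial_iso_entry PI jx.
have js : (j < size (val s))%N := LT_size_take sx jx.
have js' : (j < size (val s'))%N.
  by move/(congr1 size): sE; rewrite !size_map => <-.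
pose u := drop j.+1 (val x).
(* Past index [j], the integer naming the colour has that colour and is allowed at sum and shuffle
   nodes alike. *)
pose yv : seq rat := take j (val s') ++ q :: [seq (sharp z)%:R%R | z <- u].
have [spos _ snat] := hsharp.
have yE : map sharp yv = map sharp (val x).
  rewrite map_cat /= map_take -sE -map_take sx qE -map_comp.
  rewrite (eq_map (_ : sharp \o _ =1 sharp)); last first.
    by move=> z /=; rewrite snat.
  by rewrite -map_cons -map_cat -seq_split_nth.
have sts' : size (take j (val s')) = j by rewrite size_takel // ltnW.
have yvin : in_LT sharp T yv.
  have [xl xsum] := in_LTP _ (valP x); have [s'l s'sum] := in_LTP _ (valP s').
  apply/in_LTP; split=> [|i iy]; rewrite yE // => isum.
  rewrite /yv nth_cat sts'; case: ltnP => [ij|].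
    rewrite nth_take //; apply: s'sum; first exact: ltn_trans ij js'.
    suff -> : take i (map sharp (val s')) = take i (map sharp (val x)) by [].
    by rewrite -sE -!map_take -(take_takel _ (ltnW ij)) sx take_takel // ltnW.
  rewrite leq_eqVlt => /orP[/eqP ij|ij].
    by rewrite -ij subnn /=; apply: qsum; rewrite ij.
  rewrite -[(i - j)%N]prednK ?subn_gt0 //=.
  have ilt : ((i - j).-1 < size u)%N.
    have : (i < size (val x))%N by move: iy; rewrite -(size_map sharp) yE size_map.
    by rewrite size_drop -subnS => ix; exact: ltn_sub2r (leq_ltn_trans ij ix) ix.
  by rewrite (nth_map 0%R) // snat.
pose y : M := Sub yv yvin.
exists y; apply: partial_iso_cons => //= -[p p'] pP /=.
have ty : take j yv = take j (val s').
  by rewrite /yv take_cat sts' ltnn subnn take0 cats0.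
have [_ tE ltE] := PI _ _ ssP pP; have [_ _ ltE'] := PI _ _ pP ssP.
rewrite /= in tE ltE ltE'.
(* If [p] leaves [x] before index [j], it relates to [x] as to [s], and [p'] relates to [y] as to
   [s']. *)
have [px|px] := eqVneq (take j (val p)) (take j (val x)); last first.
  have tp : take j (val s') != take j (val p').
    by rewrite -tE sx eq_sym.
  split=> [n||].
  - have [nj|jn] := ltnP n j.
      rewrite -[take n (val x)](take_takel _ (ltnW nj)) -sx take_takel ?tE 1?ltnW //.
      by rewrite -[take n yv](take_takel _ (ltnW nj)) ty take_takel // ltnW.
    transitivity false; last apply/esym.
      apply/negbTE; apply: contra_neq px => /(congr1 (take j)).
      by rewrite !take_takel.
    apply/negbTE; apply: contra_neq tp => /(congr1 (take j)).
    by rewrite !take_takel // ty.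
  - move: ltE; rewrite /LT_lt (ltxi_takel sx) ?sx 1?eq_sym // => ->.
    by apply: (ltxi_takel (esym ty)).
  - move: ltE'; rewrite /LT_lt (ltxi_taker sx) ?sx // => ->.
    by apply: (ltxi_taker (esym ty)); rewrite eq_sym.
have jp := LT_size_take px jx.
have jp' : (j < size (val p'))%N by rewrite -(partial_iso_size PI pP).
(* By maximality of [j], the points [x] and [p] part exactly at index [j]. *)
have neq : nth 0%R (val x) j != nth 0%R (val p) j.
  apply/eqP => e; suff /jmax : Q j.+1 by rewrite ltnn.
  rewrite /Q jx; apply/hasP; exists (p, p') => //=.
  by rewrite !(take_nth 0%R) // px e.
have [xltp pltx] := qP _ pP px; rewrite /= in xltp pltx.
have sp' : take j (val s') = take j (val p').
  by apply/eqP; rewrite -tE sx px.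
have qltE : (nth 0%R (val x) j < nth 0%R (val p) j)%R =
            (q < nth 0%R (val p') j)%R.
  move: neq; rewrite neq_lt => /orP[lt|lt]; first by rewrite lt xltp.
  by rewrite !ltNge (ltW lt) (ltW (pltx lt)).
have qneq : q != nth 0%R (val p') j.
  move: neq; rewrite neq_lt => /orP[/xltp/lt_eqF->//|/pltx/gt_eqF->//].
have qltE' : (nth 0%R (val p) j < nth 0%R (val x) j)%R =
            (nth 0%R (val p') j < q)%R.
  by rewrite !lt_neqAle !leNgt qltE eq_sym neq eq_sym qneq.
rewrite /LT_lt /= /yv (seq_split_nth 0%R jx) (seq_split_nth 0%R jp).
rewrite (seq_split_nth 0%R jp') px sp'.
split=> [n||].
- by rewrite !take_cat_cons_eq // !size_takel ?eqxx // ltnW.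
- by rewrite !ltxi_cat_cons.
- by rewrite !ltxi_cat_cons // eq_sym.
Qed.

Lemma partial_iso_back P y : partial_iso P ->
  exists x, partial_iso ((x, y) :: P).
Proof.
move=> /partial_iso_swap/partial_iso_forth-/(_ y)[x /partial_iso_swap].
rewrite /= -map_comp (eq_map (_ : _ =1 id)) ?map_id; last by case.
by exists x.
Qed.

(** Since [E_t] holds of a point and itself exactly when the point lies in [D_t], taking [t] to be
    the leaves of a point and of its image shows that each leaf is a prefix of the other. Initial
    segments are then recovered by [LT_E_take]. *)
Lemma partial_isoP P : (forall p q, p \in P -> q \in P ->
    LT_lt p.1 q.1 = LT_lt p.2 q.2 /\
    forall t, t \in nodes T -> LT_E t p.1 q.1 = LT_E t p.2 q.2) <->
  partial_iso P.
Proof.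
have take_node (r : M) n : take n (map sharp (val r)) \in nodes T.
  have [rl _] := in_LTP _ (valP r); apply: take_nodes; apply/nodesP.
  by exists leaf_label.
split=> PI p q pP qP; last first.
  have [pE tE ltE] := PI _ _ pP qP; have [qE _ _] := PI _ _ qP qP.
  by split=> // t tT; rewrite /LT_E /LT_D pE qE tE.
have sharpE o : o \in P -> map sharp (val o.1) = map sharp (val o.2).
  move=> oP; have [_ EE] := PI _ _ oP oP.
  have := EE _ (take_node o.1 (size (map sharp (val o.1)))).
  have := EE _ (take_node o.2 (size (map sharp (val o.2)))).
  rewrite !take_size /LT_E /LT_D !prefix_refl !eqxx !andbT !andbb => p21 p12.
  have [o1l _] := in_LTP _ (valP o.1); have [o2l _] := in_LTP _ (valP o.2).
  by apply: leaf_prefix o1l o2l _.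
have [ltE EE] := PI _ _ pP qP; split=> //; first exact: sharpE.
by move=> n; rewrite -!LT_E_take -sharpE // EE.
Qed.

(** * Ultrahomogeneity, the linear order and the Fraïssé limit *)

Lemma LT_star_ultrahomogeneous : ultrahomogeneous (LT_star sharp T).
Proof.
move=> S S' f Sfin _ [[_ fE] _].
have /finite_seqP[s sE] : finite_set [set: set_type S].
  exact: finite_substructure Sfin.
have s_all (z : set_type S) : z \in s by have : [set` s] z by rewrite -sE.
pose P0 : seq (M * M) := [seq (val z, val (f z)) | z <- s].
pose pair (X : Type) (a b : X) (i : 'I_2) := if val i == 0%N then a else b.
have P0iso : partial_iso P0.
  apply/partial_isoP => _ _ /mapP[z _ ->] /mapP[z' _ ->] /=; split=> [|t tT].
    by apply/idP/idP; have [] := fE None (pair _ z z').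
  by apply/idP/idP; have [] := fE (Some (SeqSub tT)) (pair _ z z').
have [g gbij [gP0 gP]] := back_and_forth partial_iso_inj
  partial_iso_forth partial_iso_back P0iso.
exists g; split; last by move=> z; apply/gP0/mapP; exists z.
split=> //; split=> [|R v]; first exact: bij_inj.
(* All symbols are binary, so a single list containing both points with their images decides every
   relation. *)
have [P [PI vP vP']] := gP (v ord0) (v ord_max).
have [ltE EE] := (partial_isoP P).2 PI _ _ vP vP'.
case: R v vP vP' ltE EE => [t|] v _ _ /= ltE EE; last by rewrite ltE.
by rewrite EE //; exact: valP.
Qed.

Lemma LT_star_lt_order : strict_linear_order (@LT_lt sharp T).
Proof.
split=> [x|x y z|x y]; first by rewrite /LT_lt ltxx.
  exact: lt_trans.
have [lt|lt|/val_inj e] := ltgtP (val x : seqlexi rat) (val y : seqlexi rat).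
- exact: Or31.
- exact: Or33.
- exact: Or32.
Qed.

End PartialIsomorphisms.

Theorem theorem12 (sharp : rat -> nat) (hsharp : dense_partition sharp)
    (T : tree_presentation) :
  fraisse_order_class (lt_symbol T) (@K_T sharp T) /\
  fraisse_limit (@K_T sharp T) (LT_star sharp T).
Proof.
have hom := LT_star_ultrahomogeneous (T := T) hsharp.
split; last first.
  by split=> // [|A]; [exact: countableP|exact: finitely_embeds_age].
split=> //; first split=> [A []//|||].
- exact: finitely_embeds_hereditary.
- exact: finitely_embeds_joint_embedding.
- exact: ultrahomogeneous_amalgamation.
move=> A [_ [h [hinj hE]]].
(* The order of [A] is pulled back along [h], whose injectivity gives totality. *)
have ltE x y : binrel (lt_symbol T) x y <-> LT_lt (h x) (h y).
  exact: (hE (lt_symbol T)).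
have [irr trans tot] := LT_star_lt_order sharp T.
split=> [x /ltE/irr//|x y z|x y].
  by rewrite !ltE; exact: trans.
have [xy|/hinj xy|yx] := tot (h x) (h y).
- exact/Or31/ltE.
- exact: Or32.
- exact/Or33/ltE.
Qed.
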